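(* Let $\alpha,\beta,v\in\mathbb{R}$ be such that $|\alpha-\beta|<|v|<\alpha+\beta+2$. For $t\in(0,1)$ let $$W_{\alpha,\beta,v}(t)=t^\alpha(1-t)^\beta\left(W_2t^2+W_1t+W_0\right)$$ with $$W_2=\begin{pmatrix}\frac{v(v+2+\alpha+\beta)}{v+\alpha-\beta}&0\\0&\frac{v(-v+2+\alpha+\beta)}{v-\alpha+\beta}\end{pmatrix},\quad W_1=\begin{pmatrix}-(v+\alpha+\beta+2)&\alpha+\beta+2\\ \alpha+\beta+2&-(-v+\alpha+\beta+2)\end{pmatrix},\quad W_0=(\alpha+1)\begin{pmatrix}1&-1\\-1&1\end{pmatrix}.$$ Then $W_{\alpha,\beta,v}$ is a matrix weight on $(0,1)$, and the differential operator $$D=t(1-t)\frac{d^2}{dt^2}+(C-tU)\frac{d}{dt}-V,$$ $$C=\begin{pmatrix}\alpha+2-\frac{\alpha-\beta}{v} & \frac{v+\alpha-\beta}{v}\\ \frac{v-\alpha+\beta}{v} & \alpha+2+\frac{\alpha-\beta}{v}\end{pmatrix},\qquad U=(\alpha+\beta+4)I,\qquad V=\begin{pmatrix}v&0\\0&0\end{pmatrix},$$ is symmetric with respect to $W_{\alpha,\beta,v}$.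
   Context: $I$ is the $2\times 2$ identity matrix. A matrix weight on $(0,1)$ is a function $W:(0,1)\to\mathrm{Mat}_2(\mathbb{C})$ such that $W(t)$ is Hermitian and positive definite for every $t\in(0,1)$ and all moments $\int_0^1t^nW(t)\,dt$, $n\ge0$, are finite. For matrix-valued functions put $\langle P,Q\rangle_W=\int_0^1P^*(t)W(t)Q(t)\,dt$, where $P^*$ is the conjugate transpose. A differential operator $D$, acting from the left on $2\times2$ matrix-valued functions, is symmetric with respect to $W$ if $\langle DP,Q\rangle_W=\langle P,DQ\rangle_W$ for all $2\times2$ matrix polynomials $P,Q$. *)

(* Defs.v *)
From HB Require Import structures.
From mathcomp Require Import all_boot all_order all_algebra.
From mathcomp Require Import complex.
From mathcomp Require Import all_classical all_reals all_analysis.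
Import Order.TTheory GRing.Theory Num.Theory.
Import numFieldNormedType.Exports.

Set Implicit Arguments.
Unset Strict Implicit.
Unset Printing Implicit Defensive.

Local Open Scope classical_set_scope.
Local Open Scope ring_scope.
Local Open Scope sesquilinear_scope.
Local Open Scope complex_scope.

Section MatrixWeights.
Context {R : realType}.
Local Notation C := R[i].
Local Notation mu := (@lebesgue_measure R).

(* R[i] carries no measure theory or calculus over R in the libraries, so
   integrability, integrals and derivatives of complex-valued functions of a
   real variable are taken on the real and imaginary parts, and those of
   matrix-valued functions entrywise. *)
Definition cintegrable01 (f : R -> C) : Prop :=
  mu.-integrable `]0, 1[ (fun t => (complex.Re (f t))%:E) /\
  mu.-integrable `]0, 1[ (fun t => (complex.Im (f t))%:E).

Definition cintegral01 (f : R -> C) : C :=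
  (\int[mu]_(t in `]0, 1[) complex.Re (f t)) +i*
  (\int[mu]_(t in `]0, 1[) complex.Im (f t)).

Definition cderive (f : R -> C) (t : R) : C :=
  derive1 (fun s => complex.Re (f s)) t +i* derive1 (fun s => complex.Im (f s)) t.

Definition mxintegral01 (F : R -> 'M[C]_2) : 'M[C]_2 :=
  \matrix_(i, j) cintegral01 (fun t => F t i j).

Definition mxderive (F : R -> 'M[C]_2) (t : R) : 'M[C]_2 :=
  \matrix_(i, j) cderive (fun s => F s i j) t.

(* In the partial order of R[i], [0 < z] says that z is real and positive. *)
Definition posdefmx (M : 'M[C]_2) : Prop :=
  forall x : 'cV[C]_2, x != 0 -> 0 < (x ^t* *m M *m x) 0 0.

Definition matrix_weight (W : R -> 'M[C]_2) : Prop :=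
  (forall t, 0 < t < 1 -> W t \is hermsymmx /\ posdefmx (W t)) /\
  (forall (n : nat) (i j : 'I_2),
     cintegrable01 (fun t => (t ^+ n)%:C * W t i j)).

Definition mxinner (W P Q : R -> 'M[C]_2) : 'M[C]_2 :=
  mxintegral01 (fun t => (P t) ^t* *m W t *m Q t).

(* A matrix polynomial \sum_k A_k X^k, as the function t |-> \sum_k t^k A_k:
   the indeterminate is evaluated at the scalar matrix t I. *)
Definition mxpolyfun (P : {poly 'M[C]_2}) (t : R) : 'M[C]_2 :=
  P.[(t%:C)%:M].

Definition symmetric_wrt (W : R -> 'M[C]_2)
    (D : (R -> 'M[C]_2) -> R -> 'M[C]_2) : Prop :=
  forall P Q : {poly 'M[C]_2},
    mxinner W (D (mxpolyfun P)) (mxpolyfun Q) =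
    mxinner W (mxpolyfun P) (D (mxpolyfun Q)).

Definition mx22 (a b c d : R) : 'M[R]_2 :=
  \matrix_(i, j) if i == 0 then (if j == 0 then a else b)
                 else (if j == 0 then c else d).

Definition complexmx (M : 'M[R]_2) : 'M[C]_2 := map_mx (real_complex R) M.

Section JacobiExample.
Variables a b v : R.

Definition W2 : 'M[R]_2 :=
  mx22 (v * (v + 2 + a + b) / (v + a - b)) 0
       0 (v * (- v + 2 + a + b) / (v - a + b)).

Definition W1 : 'M[R]_2 :=
  mx22 (- (v + a + b + 2)) (a + b + 2)
       (a + b + 2) (- (- v + a + b + 2)).

Definition W0 : 'M[R]_2 := (a + 1) *: mx22 1 (-1) (-1) 1.

Definition Wabv (t : R) : 'M[C]_2 :=
  complexmx ((t `^ a * (1 - t) `^ b) *: (t ^+ 2 *: W2 + t *: W1 + W0)).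

Definition matC : 'M[R]_2 :=
  mx22 (a + 2 - (a - b) / v) ((v + a - b) / v)
       ((v - a + b) / v) (a + 2 + (a - b) / v).

Definition matU : 'M[R]_2 := (a + b + 4)%:M.

Definition matV : 'M[R]_2 := mx22 v 0 0 0.

Definition Dabv (F : R -> 'M[C]_2) (t : R) : 'M[C]_2 :=
  (t * (1 - t))%:C *: mxderive (mxderive F) t
  + complexmx (matC - t *: matU) *m mxderive F t
  - complexmx matV *m F t.

End JacobiExample.
End MatrixWeights.

(* Main.v *)
Require Import Defs.
From HB Require Import structures.
From mathcomp Require Import all_boot all_order all_algebra.
From mathcomp Require Import complex.
From mathcomp Require Import all_classical all_reals all_analysis.
From mathcomp Require Import measurable_realfun ring lra.
Import Order.TTheory GRing.Theory Num.Theory.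
Import numFieldNormedType.Exports.
Local Open Scope ring_scope.

(** Write W(t) = w(t) W^(t) with the scalar Jacobi weight
    w(t) = t^alpha (1-t)^beta and the quadratic matrix polynomial W^, and put
    s = alpha + beta + 2, d = alpha - beta.  The hypotheses say |d| < |v| < s,
    so alpha and beta exceed -1.

    Positivity.  The upper left entry of W^ is a quadratic polynomial in t with
    negative discriminant and positive leading coefficient, and the determinant
    is v^2 (s^2 - v^2) / (v^2 - d^2) t^2 (1-t)^2
    ([weight_quadratic_posdef]); a real symmetric 2 x 2 matrix with these
    two signs is positive definite on complex vectors.  All moments are finite
    because w is integrable: t + (1 - t) = 1 gives w <= t^alpha + (1-t)^beta on
    (0,1), and each summand has an explicit primitive.

    Symmetry.  For polynomial P and Q the function
    (DP)^* W Q - P^* W (DQ) is the derivative of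
    w(t) t (1-t) (P'^* W^ Q - P^* W^ Q' + P^* J Q), where J is the antisymmetric
    matrix with entries v and -v.  This is a Lagrange identity
    ([lagrange_identity]); it rests on the symmetry equations
    (t(1-t) W)' + t(1-t) w J = A^T W, its transpose, and
    (t(1-t) w J)' = W V - V W, where A = C - t U.  Since
    (t(1-t) w)' = w ((alpha+1) - s t), dividing by w turns all three into
    identities between polynomial matrices ([weight_poly_pearson],
    [weight_poly_pearson_tr], [weight_poly_commutator]), so that the whole
    argument takes place in 2 x 2 matrices over C[X].  The exponents alpha + 1
    and beta + 1 are positive, so the primitive vanishes at 0 and 1 and its
    derivative integrates to 0 ([jacobi_int_derive]); as w may be unbounded,
    this uses a fundamental theorem of calculus on open intervals
    ([improper_FTC]). *)

(** * Positive definiteness *)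

Lemma ord2_ind (P : 'I_2 -> Prop) : P 0 -> P 1 -> forall i, P i.
Proof.
move=> P0 P1 [[|[|//]] i2].
  by rewrite (_ : Ordinal i2 = 0) //; exact/val_inj.
by rewrite (_ : Ordinal i2 = 1) //; exact/val_inj.
Qed.

Lemma sum_ord2 (V : nmodType) (F : 'I_2 -> V) : \sum_(i < 2) F i = F 0 + F 1.
Proof.
rewrite !big_ord_recl big_ord0 addr0; congr (F _ + F _); exact: val_inj.
Qed.

Section PositiveDefinite.
Local Open Scope complex_scope.
Local Open Scope sesquilinear_scope.
Context {R : realType}.
Implicit Type M : 'M[R]_2.

Lemma quadform_gt0 (p q r x y : R) : 0 < p -> q ^+ 2 < p * r ->
  (x != 0) || (y != 0) -> 0 < p * x ^+ 2 + 2 * q * x * y + r * y ^+ 2.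
Proof.
move=> p0 pr xy; rewrite -(pmulr_rgt0 _ p0).
(* completing the square *)
have -> : p * (p * x ^+ 2 + 2 * q * x * y + r * y ^+ 2) =
  (p * x + q * y) ^+ 2 + (p * r - q ^+ 2) * y ^+ 2 by ring.
have [y0|y0] := eqVneq y 0.
  move: xy; rewrite y0 eqxx orbF => x0.
  by rewrite mulr0 addr0 expr0n mulr0 addr0 exprn_even_gt0//= mulf_neq0// gt_eqF.
by rewrite ltr_wpDl ?sqr_ge0// mulr_gt0 ?subr_gt0// exprn_even_gt0.
Qed.

Lemma hermsymmx_complexmx M : M^T = M -> complexmx M \is hermsymmx.
Proof.
move=> MT; apply/is_hermitianmxP; rewrite expr0 scale1r.
apply/matrixP => i j; rewrite !mxE -[in LHS]MT mxE.
exact/esym/conjc_real.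
Qed.

(** A real symmetric form takes at x + i y the sum of its values at x and at y,
    the mixed terms cancelling by symmetry; hence positivity on real vectors is
    enough. *)
Lemma posdefmx_complexmx M : M^T = M -> 0 < M 0 0 ->
  M 0 1 ^+ 2 < M 0 0 * M 1 1 -> posdefmx (complexmx M).
Proof.
move=> MT M00 detM x x0.
have M10 : M 1 0 = M 0 1 by rewrite -[in LHS]MT mxE.
case E0 : (x 0 0) => [x1 y1]; case E1 : (x 1 0) => [x2 y2].
have -> : (x ^t* *m complexmx M *m x) 0 0 =
  ((M 0 0 * x1 ^+ 2 + 2 * M 0 1 * x1 * x2 + M 1 1 * x2 ^+ 2) +
   (M 0 0 * y1 ^+ 2 + 2 * M 0 1 * y1 * y2 + M 1 1 * y2 ^+ 2))%:C.
  rewrite !mxE !sum_ord2 !mxE !sum_ord2 !mxE E0 E1 M10 -![Num.conj _]/(conjc _).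
  move: (M 0 0) (M 0 1) (M 1 1) => p q r.
  by simpc; congr (_ +i* _); ring.
rewrite ltcR.
have qge0 (u w : R) : 0 <= M 0 0 * u ^+ 2 + 2 * M 0 1 * u * w + M 1 1 * w ^+ 2.
  have [/andP[/eqP-> /eqP->]|] := boolP ((u == 0) && (w == 0)).
    by rewrite !(mulr0, expr0n) !addr0.
  by rewrite negb_and => uw; exact/ltW/quadform_gt0.
have [xne|] := boolP ((x1 != 0) || (x2 != 0)).
  by rewrite ltr_pwDl// quadform_gt0.
rewrite negb_or !negbK => /andP[/eqP x10 /eqP x20].
rewrite ltr_pwDr// quadform_gt0//; apply: contraNT x0.
rewrite negb_or !negbK => /andP[/eqP y10 /eqP y20].
apply/eqP/matrixP => i j; rewrite ord1 mxE; move: i.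
by apply: ord2_ind; rewrite ?E0 ?E1 ?x10 ?x20 ?y10 ?y20.
Qed.

(** Both signs come from v^2 - d^2 > 0 and s^2 - v^2 > 0, where s = a + b + 2
    and d = a - b.  With w the leading coefficient of W 0 0,
    w W_00 = (w t - (v+s)/2)^2 + (s^2 - v^2)(v^2 - d^2) / (4 (v+d)^2), and the
    determinant is v^2 (s^2 - v^2) / (v^2 - d^2) (t (1-t))^2. *)
Lemma weight_quadratic_posdef (a b v t : R) :
    `|a - b| < `|v| -> `|v| < a + b + 2 -> 0 < t < 1 ->
  let W := t ^+ 2 *: W2 a b v + t *: W1 a b v + W0 a in
  0 < W 0 0 /\ W 0 1 ^+ 2 < W 0 0 * W 1 1.
Proof.
move=> h1 h2 /andP[t0 t1] W.
have vd : 0 < v ^+ 2 - (a - b) ^+ 2.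
  by rewrite subr_gt0 -(real_normK (num_real (a - b)))
    -(real_normK (num_real v)) ltr_pXn2r// nnegrE.
have sv : 0 < (a + b + 2) ^+ 2 - v ^+ 2.
  rewrite subr_gt0 -(real_normK (num_real v)) ltr_pXn2r// nnegrE//.
  exact: le_trans (ltW h2).
have vs : 0 < v + a + b + 2 by move: h2; rewrite ltr_norml => /andP[? ?]; lra.
have vdE : v ^+ 2 - (a - b) ^+ 2 = (v + a - b) * (v - a + b) by ring.
have : (v + a - b) * (v - a + b) != 0 by rewrite -vdE gt_eqF.
rewrite mulf_eq0 negb_or => /andP[vp vm].
have vp2 : 0 < (v + a - b) ^+ 2 by rewrite exprn_even_gt0.
have W00 : W 0 0 = v * (v + 2 + a + b) / (v + a - b) * t ^+ 2
    - (v + a + b + 2) * t + (a + 1) by rewrite !mxE/=; ring.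
have W01 : W 0 1 = (a + b + 2) * t - (a + 1) by rewrite !mxE/=; ring.
have W11 : W 1 1 = v * (- v + 2 + a + b) / (v - a + b) * t ^+ 2
    - (- v + a + b + 2) * t + (a + 1) by rewrite !mxE/=; ring.
clearbody W; split; last first.
  rewrite -subr_gt0.
  have -> : W 0 0 * W 1 1 - W 0 1 ^+ 2 =
      v ^+ 2 * ((a + b + 2) ^+ 2 - v ^+ 2) / (v ^+ 2 - (a - b) ^+ 2)
      * (t * (1 - t)) ^+ 2.
    by rewrite W00 W01 W11 vdE; field; rewrite vp vm.
  have v2 : 0 < v ^+ 2 by have := sqr_ge0 (a - b); lra.
  have tt : 0 < t * (1 - t) by rewrite mulr_gt0// subr_gt0.
  by apply: mulr_gt0; [apply: divr_gt0 => //; exact: mulr_gt0|exact: exprn_gt0].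
pose w := v * (v + 2 + a + b) / (v + a - b).
(* v and v + d have the same sign: 2 v (v + d) = (v + d)^2 + (v^2 - d^2) *)
have w0 : 0 < w.
  have -> : w = ((v + a - b) ^+ 2 + (v ^+ 2 - (a - b) ^+ 2)) / 2
      * (v + a + b + 2) / (v + a - b) ^+ 2 by rewrite /w; field.
  by apply: divr_gt0 => //; apply: mulr_gt0 => //; lra.
rewrite -(pmulr_rgt0 _ w0).
have -> : w * W 0 0 = (w * t - (v + a + b + 2) / 2) ^+ 2
    + ((a + b + 2) ^+ 2 - v ^+ 2) * (v ^+ 2 - (a - b) ^+ 2)
      / (4 * (v + a - b) ^+ 2).
  by rewrite W00 /w; field.
rewrite ltr_wpDl ?sqr_ge0//; apply: divr_gt0; first exact: mulr_gt0.
by apply: mulr_gt0.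
Qed.

End PositiveDefinite.

(** * The fundamental theorem of calculus on open intervals *)

Section ImproperFTC.
Local Open Scope classical_set_scope.
Local Open Scope ring_scope.
Context {R : realType}.
Local Notation mu := (@lebesgue_measure R).
Variables (a b : R) (f F : R -> R) (la lb : R).
Hypothesis ab : a < b.
Hypothesis dF : {in `]a, b[, forall x : R, is_derive x 1 F (f x)}.
Hypothesis cf : {in `]a, b[, continuous f}.
Hypothesis Fa : F x @[x --> a^'+] --> la.
Hypothesis Fb : F x @[x --> b^'-] --> lb.

(* The compact intervals S_ n exhaust ]a, b[; the offset 3 makes them
   nondegenerate, as 2 (b - a) / (n + 3) < b - a. *)
Let e_ (n : nat) : R := (b - a) / n.+3%:R.
Let S_ (n : nat) : set R := `[a + e_ n, b - e_ n].

Let e_gt0 n : 0 < e_ n.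
Proof. by rewrite divr_gt0// subr_gt0. Qed.

Let e_lt n : e_ n + e_ n < b - a.
Proof.
rewrite /e_ -mulrDr gtr_pMr ?subr_gt0//.
have : (n.+3%:R)^-1 < 2^-1 :> R by rewrite ltf_pV2 ?posrE// ltr_nat.
by move: (n.+3%:R)^-1 => u ?; lra.
Qed.

Let e_cvg0 : e_ n @[n --> \oo] --> 0.
Proof.
rewrite -(mulr0 (b - a)); apply: cvgMr.
have := @cvg_harmonic R; rewrite -(cvg_shiftn 2).
by under eq_cvg do rewrite /= addn2.
Qed.

Let S_homo : {homo S_ : n m / (n <= m)%N >-> (n <= m)%O}.
Proof.
move=> n m nm; apply/subsetPset => x; rewrite /S_ /= !in_itv/=.
suff : e_ m <= e_ n.
  by move=> emn /andP[? ?]; apply/andP; split; lra.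
by rewrite /e_ ler_pM2l ?subr_gt0// lef_pV2 ?posrE// ler_nat !ltnS.
Qed.

Let S_sub n : S_ n `<=` `]a, b[.
Proof.
move=> x; rewrite /S_ /= !in_itv/= => /andP[? ?].
by have := e_gt0 n; move=> ?; apply/andP; split; lra.
Qed.

Let mem_S x : x \in `]a, b[ -> \forall n \near \oo, S_ n x.
Proof.
rewrite in_itv/= => /andP[ax xb].
have h : 0 < Num.min (x - a) (b - x) by rewrite lt_min !subr_gt0 ax xb.
near=> n.
have : e_ n < Num.min (x - a) (b - x).
  by near: n; move/cvgrPdist_lt : e_cvg0 => /(_ _ h); apply: filterS => n;
    rewrite sub0r normrN gtr0_norm.
rewrite lt_min => /andP[? ?].
by rewrite /S_ /= in_itv/=; apply/andP; split; lra.
Unshelve. all: by end_near. Qed.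

Let S_bigcup : \bigcup_n S_ n = `]a, b[%classic.
Proof.
apply/seteqP; split => [x [n _ /S_sub]//|x xab].
by have [N _ /(_ N (leqnn N)) ?] := @mem_S x xab; exists N.
Qed.

Let integral_S n : (\int[mu]_(x in S_ n) (f x)%:E =
  (F (b - e_ n) - F (a + e_ n))%:E)%E.
Proof.
have Sab x : x \in `[a + e_ n, b - e_ n] -> x \in `]a, b[ by apply: (@S_sub n).
have xy : a + e_ n < b - e_ n by have := e_lt n; move=> ?; lra.
rewrite EFinB; apply: continuous_FTC2 => //.
- apply: continuous_in_subspaceT => x /[!inE] xab; exact/cf/Sab.
- have : {within `[a + e_ n, b - e_ n], continuous F}.
    by apply: derivable_within_continuous => x /Sab /dF[].
  move/(continuous_within_itvP _ xy) => [_ ? ?]; split => // x xab.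
  by have [] : is_derive x 1 F (f x) by apply/dF/Sab/subset_itv_oo_cc.
- move=> x xab; have [] : is_derive x 1 F (f x) by apply/dF/Sab/subset_itv_oo_cc.
  by rewrite derive1E.
Qed.

Let integral_S_cvg :
  (\int[mu]_(x in S_ n) (f x)%:E @[n --> \oo] --> (lb - la)%:E)%E.
Proof.
under eq_cvg do rewrite integral_S.
apply: cvg_EFin; first exact: nearW.
apply: cvgB.
- move/cvg_at_leftP : Fb; apply; split => [n|]; first by rewrite gtrBl.
  by rewrite -[X in _ --> X]subr0; apply: cvgB; [exact: cvg_cst|exact: e_cvg0].
- move/cvg_at_rightP : Fa; apply; split => [n|]; first by rewrite ltrDl.
  by rewrite -[X in _ --> X]addr0; apply: cvgD; [exact: cvg_cst|exact: e_cvg0].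
Qed.

Let measurable_f : measurable_fun `]a, b[ f.
Proof.
apply: open_continuous_measurable_fun; first exact: interval_open.
by move=> x /[!inE]; apply: cf.
Qed.

(** Monotone convergence along an exhaustion by compact intervals, on each of
    which f is bounded.  Finiteness of the value then makes f integrable. *)
Lemma ge0_improper_FTC : {in `]a, b[, forall x, 0 <= f x} ->
  (\int[mu]_(x in `]a, b[) (f x)%:E = (lb - la)%:E)%E.
Proof.
move=> f0; rewrite -S_bigcup.
rewrite -(cvg_lim _ integral_S_cvg)//; apply/esym/cvg_lim => //.
apply: ge0_nondecreasing_set_cvg_integral => //.
- by move=> n; exact: measurable_itv.
- move=> n; apply/measurable_EFinP; apply: measurable_funS measurable_f => //.
- by move=> n x /S_sub xab; rewrite lee_fin f0.
Qed.

Lemma ge0_improper_FTC_integrable : {in `]a, b[, forall x, 0 <= f x} ->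
  mu.-integrable `]a, b[ (EFin \o f).
Proof.
move=> f0; apply/integrableP; split; first exact/measurable_EFinP.
under eq_integral => x /[!inE] xab do rewrite /= ger0_norm ?f0//.
by rewrite ge0_improper_FTC// ltry.
Qed.

(** For f of arbitrary sign the same exhaustion works by dominated convergence,
    with the integrable function |f| as the bound. *)
Lemma improper_FTC : mu.-integrable `]a, b[ (EFin \o f) ->
  \int[mu]_(x in `]a, b[) f x = lb - la.
Proof.
move=> fi; rewrite /Rintegral.
have mab : measurable (`]a, b[%classic : set R) by exact: measurable_itv.
have mS n : measurable (S_ n) by exact: measurable_itv.
pose f_ n : R -> \bar R := (EFin \o f) \_ (S_ n).
case: (@dominated_convergence _ _ _ mu _ mab f_ (EFin \o f)
  (abse \o (EFin \o f))).
- move=> n; rewrite /f_; apply/measurable_restrict; [exact: mS|exact: mab|].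
  by apply: (measurable_funS mab); [exact: subIsetl|exact/measurable_EFinP].
- exact/measurable_EFinP.
- apply: aeW => x xab; apply: cvg_near_cst; have := @mem_S x xab.
  by apply: filterS => n Sx; rewrite /f_ patchE mem_set.
- exact: integrable_abse.
- apply: aeW => x n xab; rewrite /f_ patchE; case: ifP => //= _.
  by rewrite normr0 lee_fin.
- move=> _ _ fcvg; rewrite -[RHS]/(fine (lb - la)%:E); congr fine.
  rewrite -(cvg_lim _ integral_S_cvg)//; apply/esym/cvg_lim => //.
  rewrite (_ : (fun n => _) = fun n => \int[mu]_(x in `]a, b[) f_ n x)%E//.
  by apply/funext => n; rewrite -integral_mkcondr setIidr.
Qed.

End ImproperFTC.

(** * The scalar Jacobi weight *)

Section JacobiWeight.
Local Open Scope classical_set_scope.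
Local Open Scope ring_scope.
Context {R : realType}.
Local Notation mu := (@lebesgue_measure R).
Implicit Types (a b t : R) (q : {poly R}).

Definition jacobi_weight a b t : R := t `^ a * (1 - t) `^ b.

Lemma is_derive_continuous (f : R -> R) (x df : R) :
  is_derive x 1 f df -> {for x, continuous f}.
Proof. by case=> /derivable1_diffP /differentiable_continuous. Qed.

Lemma powRD1 (x c : R) : 0 < x -> x `^ (c + 1) = x `^ c * x.
Proof. by move=> x0; rewrite powRD ?powRr1 ?ltW// (gt_eqF x0) implybT. Qed.

Lemma jacobi_gt0 a b t : 0 < t < 1 -> 0 < jacobi_weight a b t.
Proof. by move=> /andP[t0 t1]; rewrite mulr_gt0// powR_gt0// subr_gt0. Qed.

Lemma is_derive_onem t : is_derive t 1 (fun s : R => 1 - s) (-1).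
Proof.
exact: is_derive_eq
  (is_deriveB (is_derive_cst _ _ _) (is_derive_id _ _)) (sub0r _).
Qed.

Lemma is_derive_powR_onem b t : t < 1 ->
  is_derive t 1 (fun s => (1 - s) `^ b) (- (b * (1 - t) `^ (b - 1))).
Proof.
move=> t1; have t1' : 0 < 1 - t by rewrite subr_gt0.
have d := @is_derive1_comp R (fun s => s `^ b) (fun s => 1 - s) t _ _
  (is_derive1_powR b t1') (is_derive_onem t).
exact: is_derive_eq d (mulrN1 _).
Qed.

(** Differentiating t^(a+1) (1-t)^(b+1) releases the factor t^a (1-t)^b times
    (a+1)(1-t) - (b+1) t = a + 1 - (a + b + 2) t. *)
Lemma is_derive_jacobi_horner a b q t : 0 < t < 1 ->
  is_derive t 1 (fun s => jacobi_weight (a + 1) (b + 1) s * q.[s])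
    (jacobi_weight a b t *
     ((a + 1 - (a + b + 2) * t) * q.[t] + t * (1 - t) * q^`().[t])).
Proof.
move=> /andP[t0 t1]; have t1' : 0 < 1 - t by rewrite subr_gt0.
have dt := is_derive1_powR (a + 1) t0.
have d1t := @is_derive_powR_onem (b + 1) _ t1.
have dq : is_derive t 1 (horner q) q^`().[t].
  by rewrite derivE derive1E; apply/derivableP/derivable_horner.
apply: (is_derive_eq (is_deriveM (is_deriveM dt d1t) dq)).
have mulE (f g : R -> R) : (f * g) t = f t * g t by [].
by rewrite mulE !addrK /jacobi_weight !powRD1// /GRing.scale/=; ring.
Qed.

Lemma continuous_jacobi a b : {in `]0, 1[, continuous (jacobi_weight a b)}.
Proof.
move=> t; rewrite in_itv/= => /andP[t0 t1]; apply: cvgM.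
  exact: is_derive_continuous (is_derive1_powR a t0).
exact: is_derive_continuous (@is_derive_powR_onem b _ t1).
Qed.

Lemma cvg_onem_powR_left1 b : 0 < b -> (1 - t) `^ b @[t --> 1^'-] --> 0.
Proof.
move=> b0; apply: (@decreasing_cvg_at_left_comp R (fun t => 1 - t)
  (fun t => t `^ b) (BLeft 0) 1 0) => //.
- by rewrite bnd_simp.
- by move=> x y _ _; rewrite ltrD2l ltrN2.
- by apply: cvgB; [exact: cvg_cst|exact: cvg_at_left_filter].
- by rewrite subrr; exact: powR_cvg0.
Qed.

Lemma cvg_powR_left1 a : t `^ a @[t --> 1^'-] --> 1 `^ a.
Proof.
apply: cvg_at_left_filter.
exact: is_derive_continuous (is_derive1_powR a ltr01).
Qed.

Lemma cvg_onem_powR_right0 b : (1 - t) `^ b @[t --> 0^'+] --> (1 - 0) `^ b.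
Proof.
apply: (@cvg_at_right_filter _ _ (fun t => (1 - t) `^ b)).
exact: is_derive_continuous (@is_derive_powR_onem b _ (@ltr01 R)).
Qed.

Lemma cvg_jacobi_horner_right0 a b q : 0 < a ->
  jacobi_weight a b t * q.[t] @[t --> 0^'+] --> 0.
Proof.
move=> a0; rewrite -[X in _ --> X](mul0r q.[0]); apply: cvgM; last first.
  by apply: cvg_at_right_filter; exact: continuous_horner.
rewrite -[X in _ --> X](mul0r ((1 - 0) `^ b)); apply: cvgM; first exact: powR_cvg0.
exact: cvg_onem_powR_right0.
Qed.

Lemma cvg_jacobi_horner_left1 a b q : 0 < b ->
  jacobi_weight a b t * q.[t] @[t --> 1^'-] --> 0.
Proof.
move=> b0; rewrite -[X in _ --> X](mul0r q.[1]); apply: cvgM; last first.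
  by apply: cvg_at_left_filter; exact: continuous_horner.
rewrite -[X in _ --> X](mulr0 (1 `^ a)); apply: cvgM; first exact: cvg_powR_left1.
exact: cvg_onem_powR_left1.
Qed.

Lemma measurable_jacobi a b : measurable_fun (`]0, 1[ : set R) (jacobi_weight a b).
Proof.
apply: open_continuous_measurable_fun; first exact: interval_open.
by move=> x /[!inE]; apply: continuous_jacobi.
Qed.

Lemma integrable_powR a : -1 < a ->
  mu.-integrable `]0, 1[ (EFin \o (fun t => t `^ a)).
Proof.
move=> a1; have a1' : 0 < a + 1 by lra.
apply: (@ge0_improper_FTC_integrable _ 0 1 _ (fun t => (a + 1)^-1 * t `^ (a + 1))
  ((a + 1)^-1 * 0) ((a + 1)^-1 * 1 `^ (a + 1))) => //.
- move=> t; rewrite in_itv/= => /andP[t0 t1].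
  have dt := is_derive1_powR (a + 1) t0.
  apply: is_derive_eq; rewrite addrK /GRing.scale/=; field; lra.
- move=> t; rewrite in_itv/= => /andP[t0 t1].
  exact: is_derive_continuous (is_derive1_powR a t0).
- by apply: cvgMr; exact: powR_cvg0.
- by apply: cvgMr; exact: cvg_powR_left1.
- by move=> t _; exact: powR_ge0.
Qed.

Lemma integrable_onem_powR b : -1 < b ->
  mu.-integrable `]0, 1[ (EFin \o (fun t => (1 - t) `^ b)).
Proof.
move=> b1; have b1' : 0 < b + 1 by lra.
apply: (@ge0_improper_FTC_integrable _ 0 1 _
  (fun t => - (b + 1)^-1 * (1 - t) `^ (b + 1))
  (- (b + 1)^-1 * (1 - 0) `^ (b + 1)) (- (b + 1)^-1 * 0)) => //.
- move=> t; rewrite in_itv/= => /andP[t0 t1].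
  have dt := @is_derive_powR_onem (b + 1) _ t1.
  apply: is_derive_eq; rewrite addrK /GRing.scale/=; field; lra.
- move=> t; rewrite in_itv/= => /andP[t0 t1].
  exact: is_derive_continuous (@is_derive_powR_onem b _ t1).
- by apply: cvgMr; exact: cvg_onem_powR_right0.
- by apply: cvgMr; exact: cvg_onem_powR_left1.
- by move=> t _; exact: powR_ge0.
Qed.

(** Splitting off 1 = (1 - t) + t separates the two singularities: each term
    keeps one possibly negative exponent, and the other factor is at most 1. *)
Lemma integrable_jacobi a b : -1 < a -> -1 < b ->
  mu.-integrable `]0, 1[ (EFin \o jacobi_weight a b).
Proof.
move=> a1 b1.
have : mu.-integrable `]0, 1[
    (fun t => (t `^ a)%R%:E + ((1 - t) `^ b)%R%:E)%E.
  by apply: integrableD; [exact: measurable_itv|exact: integrable_powR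
                         |exact: integrable_onem_powR].
apply: le_integrable; first exact: measurable_itv.
  by apply/measurable_EFinP; exact: measurable_jacobi.
move=> t; rewrite /= in_itv/= => t01; have /andP[t0 t1] := t01.
have ge0 c (x : R) : 0 <= x `^ c by exact: powR_ge0.
have j0 : 0 <= jacobi_weight a b t by rewrite ltW// jacobi_gt0.
rewrite lee_fin (ger0_norm j0) ger0_norm ?addr_ge0//.
have t1' : 0 < 1 - t by rewrite subr_gt0.
have -> : jacobi_weight a b t = t `^ a * (1 - t) `^ (b + 1)
                       + t `^ (a + 1) * (1 - t) `^ b.
  by rewrite /jacobi_weight !powRD1//; ring.
have le1 (x c : R) : 0 < x < 1 -> 0 <= c -> x `^ c <= 1.
  move=> /andP[x0 x1] c0; rewrite -(powRr0 x).
  by apply: ger_powR => //; rewrite x0 ltW.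
rewrite lerD//.
  by rewrite ler_piMr// le1 ?t1' ?gtrBl//; lra.
by rewrite ler_piMl// le1//; lra.
Qed.

(** By induction on the degree: a factor t is absorbed in the exponent a. *)
Lemma integrable_jacobi_horner a b q : -1 < a -> -1 < b ->
  mu.-integrable `]0, 1[ (EFin \o (fun t => jacobi_weight a b t * q.[t])).
Proof.
move=> a1 b1; elim/poly_ind: q a a1 => [|q c IH] a a1.
  apply: eq_integrable (integrable0 _ _) => // t _.
  by rewrite /= horner0 mulr0.
have : mu.-integrable `]0, 1[ (fun t =>
    (jacobi_weight (a + 1) b t * q.[t])%R%:E + c%:E * (jacobi_weight a b t)%:E)%E.
  apply: integrableD; [exact: measurable_itv|apply: IH; lra|].
  by apply: integrableZl; [exact: measurable_itv|exact: integrable_jacobi].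
apply: eq_integrable => // t; rewrite inE/= in_itv/= => /andP[t0 t1].
by rewrite hornerMXaddC -EFinM -EFinD /jacobi_weight powRD1//; congr EFin; ring.
Qed.

(** The integrand is the derivative of t^(a+1) (1-t)^(b+1) q(t), which vanishes
    at both ends because a + 1 and b + 1 are positive. *)
Lemma Rintegral_jacobi_derive a b q : -1 < a -> -1 < b ->
  \int[mu]_(t in `]0, 1[) (jacobi_weight a b t *
    (((a + 1)%:P - (a + b + 2) *: 'X) * q + 'X * (1 - 'X) * q^`()).[t]) = 0.
Proof.
move=> a1 b1; rewrite -[RHS](subrr 0).
apply: (@improper_FTC _ 0 1 _ (fun t => jacobi_weight (a + 1) (b + 1) t * q.[t])) => //.
- move=> t; rewrite in_itv/= => t01.
  have := is_derive_jacobi_horner a b q _ t01.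
  by rewrite !hornerE.
- move=> t t01; apply: cvgM; first exact: continuous_jacobi.
  exact: continuous_horner.
- by apply: cvg_jacobi_horner_right0; lra.
- by apply: cvg_jacobi_horner_left1; lra.
- exact: integrable_jacobi_horner.
Qed.

End JacobiWeight.

(** * Complex polynomials of a real variable *)

Section ComplexPolynomials.
Local Open Scope classical_set_scope.
Local Open Scope ring_scope.
Local Open Scope complex_scope.
Context {R : realType}.
Local Notation C := R[i].
Local Notation mu := (@lebesgue_measure R).
Implicit Types (p q : {poly C}) (t : R).
Local Notation toC := (map_poly (real_complex R)).
Local Notation RePoly := (map_poly (@complex.Re R)).
Local Notation ImPoly := (map_poly (@complex.Im R)).

Lemma poly_complexE p : p = toC (RePoly p) + 'i%C *: toC (ImPoly p).
Proof.
by apply/polyP => k; rewrite coefD coefZ !coef_map/= -complexE.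
Qed.

Lemma Re_horner p t : complex.Re p.[t%:C] = (RePoly p).[t].
Proof.
rewrite [in LHS](poly_complexE p) hornerD hornerZ !horner_map/=.
by simpc.
Qed.

Lemma Im_horner p t : complex.Im p.[t%:C] = (ImPoly p).[t].
Proof.
rewrite [in LHS](poly_complexE p) hornerD hornerZ !horner_map/=.
by simpc.
Qed.

Lemma Re_realM (x : R) (z : C) : complex.Re (x%:C * z) = x * complex.Re z.
Proof. by case: z => u w; simpc. Qed.

Lemma Im_realM (x : R) (z : C) : complex.Im (x%:C * z) = x * complex.Im z.
Proof. by case: z => u w; simpc. Qed.

Lemma RePoly_deriv p : RePoly p^`() = (RePoly p)^`().
Proof. by apply/polyP => k; rewrite coef_map !coef_deriv coef_map/= raddfMn. Qed.

Lemma ImPoly_deriv p : ImPoly p^`() = (ImPoly p)^`().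
Proof. by apply/polyP => k; rewrite coef_map !coef_deriv coef_map/= raddfMn. Qed.

Lemma RePoly_toCM (r : {poly R}) p : RePoly (toC r * p) = r * RePoly p.
Proof.
apply/polyP => k; rewrite coef_map !coefM raddf_sum; apply: eq_bigr => i _.
by rewrite !coef_map; exact: Re_realM.
Qed.

Lemma ImPoly_toCM (r : {poly R}) p : ImPoly (toC r * p) = r * ImPoly p.
Proof.
apply/polyP => k; rewrite coef_map !coefM raddf_sum; apply: eq_bigr => i _.
by rewrite !coef_map; exact: Im_realM.
Qed.

Lemma cderive_horner p t : cderive (fun s => p.[s%:C]) t = p^`().[t%:C].
Proof.
rewrite /cderive [RHS]complexE Re_horner Im_horner.
under [X in derive1 X]eq_fun do rewrite Re_horner.
under [X in _ +i* derive1 X _]eq_fun do rewrite Im_horner.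
rewrite -!derivE RePoly_deriv ImPoly_deriv.
exact: complexE.
Qed.

Variables a b : R.
Hypotheses (a1 : -1 < a) (b1 : -1 < b).

(** Every entry of the inner product of two matrix polynomials is the value of
    this functional at a polynomial. *)
Definition jacobi_int p : C :=
  cintegral01 (fun t => (jacobi_weight a b t)%:C * p.[t%:C]).

Lemma cintegrable_jacobi p :
  cintegrable01 (fun t => (jacobi_weight a b t)%:C * p.[t%:C]).
Proof.
split.
  apply: eq_integrable (@integrable_jacobi_horner _ a b (RePoly p) a1 b1).
    exact: measurable_itv.
  by move=> t _ /=; rewrite Re_realM Re_horner.
apply: eq_integrable (@integrable_jacobi_horner _ a b (ImPoly p) a1 b1).
  exact: measurable_itv.
by move=> t _ /=; rewrite Im_realM Im_horner.
Qed.

Lemma jacobi_intE p : jacobi_int p =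
  (\int[mu]_(t in `]0, 1[) (jacobi_weight a b t * (RePoly p).[t])) +i*
  (\int[mu]_(t in `]0, 1[) (jacobi_weight a b t * (ImPoly p).[t])).
Proof.
by congr (_ +i* _); apply: eq_Rintegral => t _;
  rewrite ?Re_realM ?Im_realM ?Re_horner ?Im_horner.
Qed.

Lemma jacobi_intB p q : jacobi_int (p - q) = jacobi_int p - jacobi_int q.
Proof.
have intB (r s : {poly R}) :
    \int[mu]_(t in `]0, 1[) (jacobi_weight a b t * (r - s).[t]) =
    \int[mu]_(t in `]0, 1[) (jacobi_weight a b t * r.[t]) -
    \int[mu]_(t in `]0, 1[) (jacobi_weight a b t * s.[t]).
  rewrite -RintegralB; [|exact: measurable_itv|exact: integrable_jacobi_horner..].
  by apply: eq_Rintegral => t _; rewrite hornerD hornerN mulrBr.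
by rewrite !jacobi_intE !raddfB/= !intB.
Qed.

Lemma jacobi_int_derive q :
  jacobi_int (toC ((a + 1)%:P - (a + b + 2) *: 'X) * q
              + toC ('X * (1 - 'X)) * q^`()) = 0.
Proof.
rewrite jacobi_intE.
set l := (a + 1)%:P - _; set s := 'X * _.
rewrite (raddfD RePoly) (raddfD ImPoly)/= !RePoly_toCM !ImPoly_toCM.
by rewrite RePoly_deriv ImPoly_deriv !Rintegral_jacobi_derive.
Qed.

End ComplexPolynomials.

(** * Polynomial matrices of a real variable *)

Section PolynomialMatrices.
Local Open Scope complex_scope.
Context {R : realType}.
Local Notation C := R[i].
Implicit Types (A B : 'M[{poly C}]_2) (P : {poly 'M[C]_2}) (M : 'M[R]_2) (t : R).
Local Open Scope sesquilinear_scope.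

(** Working with matrices of polynomials, instead of polynomials with matrix
    coefficients, makes products and derivatives entrywise over the commutative
    ring C[X]. *)
Definition mxeval A t : 'M[C]_2 := map_mx (horner_eval t%:C) A.

Definition mxpoly_entries P : 'M[{poly C}]_2 :=
  \matrix_(i, j) \poly_(k < size P) P`_k i j.

Lemma mxpolyfunE P : mxpolyfun P = mxeval (mxpoly_entries P).
Proof.
apply/funext => t; apply/matrixP => i j; rewrite /mxpolyfun !mxE.
rewrite horner_coef summxE /horner_eval horner_poly.
apply: eq_bigr => k _; rewrite -rmorphXn/= -[_ * _]/(_ *m _).
by rewrite mul_mx_scalar mxE mulrC.
Qed.

Definition mxderiv A : 'M[{poly C}]_2 := map_mx (@deriv C) A.

Lemma mxderive_mxeval A : mxderive (mxeval A) = mxeval (mxderiv A).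
Proof.
apply/funext => t; apply/matrixP => i j; rewrite !mxE /horner_eval -cderive_horner.
by congr cderive; apply/funext => s; rewrite mxE.
Qed.

Lemma mxderivM A B : mxderiv (A *m B) = mxderiv A *m B + A *m mxderiv B.
Proof.
apply/matrixP => i j; rewrite !mxE raddf_sum -big_split/=.
by apply: eq_bigr => k _; rewrite derivM !mxE.
Qed.

Definition constmx M : 'M[{poly C}]_2 := map_mx (polyC \o real_complex R) M.

Lemma mxeval_constmx M t : mxeval (constmx M) t = complexmx M.
Proof. by apply/matrixP => i j; rewrite !mxE /horner_eval/= hornerC. Qed.

Lemma mxevalD A B t : mxeval (A + B) t = mxeval A t + mxeval B t.
Proof. exact: map_mxD. Qed.

Lemma mxevalN A t : mxeval (- A) t = - mxeval A t.
Proof. exact: map_mxN. Qed.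

Lemma mxevalM A B t : mxeval (A *m B) t = mxeval A t *m mxeval B t.
Proof. exact: map_mxM. Qed.

Lemma mxevalZ p A t : mxeval (p *: A) t = p.[t%:C] *: mxeval A t.
Proof. exact: map_mxZ. Qed.

(** Only coefficients are conjugated, as the variable stands for a real
    number. *)
Definition adjmx A : 'M[{poly C}]_2 := map_mx (map_poly (@conjc R)) A^T.

Lemma adjmx_mxeval A t : (mxeval A t)^t* = mxeval (adjmx A) t.
Proof.
apply/matrixP => i j; rewrite !mxE /horner_eval.
rewrite -[in RHS](conjc_real t).
exact/esym/horner_map.
Qed.

End PolynomialMatrices.

(** * The symmetry equations *)

(** The Lagrange identity with the derivatives as free matrices: W' = dW,
    X' = X1, X1' = X2, Y' = Y1 and Y1' = Y2.  The coefficients of X1 and of Y1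
    match by the first two hypotheses, in which s J enters with opposite signs,
    and the terms without derivatives match by the third. *)
Lemma mulmx_lagrange (T : comNzRingType) (n : nat)
    (W dW J D D' V X X1 X2 Y Y1 Y2 : 'M[T]_n) (l s : T) :
  l *: W + s *: dW + s *: J = D' *m W ->
  l *: W + s *: dW - s *: J = W *m D ->
  l *: J = W *m V - V *m W ->
  (s *: X2 + X1 *m D' - X *m V) *m W *m Y
    - X *m W *m (s *: Y2 + D *m Y1 - V *m Y) =
  l *: (X1 *m W *m Y - X *m W *m Y1 + X *m J *m Y)
  + s *: (X2 *m W *m Y + X1 *m dW *m Y + X1 *m W *m Y1
          - (X1 *m W *m Y1 + X *m dW *m Y1 + X *m W *m Y2)
          + (X1 *m J *m Y + X *m J *m Y1)).
Proof.
move=> h1 h2 h3.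
have -> : (s *: X2 + X1 *m D' - X *m V) *m W *m Y =
   s *: (X2 *m W *m Y) + X1 *m (D' *m W) *m Y - X *m (V *m W) *m Y.
  by rewrite !mulmxBl !mulmxDl -!scalemxAl !mulmxA.
have -> : X *m W *m (s *: Y2 + D *m Y1 - V *m Y) =
   s *: (X *m W *m Y2) + X *m (W *m D) *m Y1 - X *m (W *m V) *m Y.
  by rewrite !mulmxBr !mulmxDr -!scalemxAr !mulmxA.
rewrite -h1 -h2 -[W *m V](subrK (V *m W)) -h3.
rewrite !(mulmxDr, mulmxDl, mulmxN, mulNmx) -!(scalemxAr, scalemxAl).
(* The products are now atoms of a linear identity. *)
apply/matrixP => i j; rewrite !(scalerDr, scalerN, opprD, opprK).
move: (X2 *m W *m Y) (X *m W *m Y2) (X1 *m W *m Y) (X *m W *m Y1)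
  (X *m J *m Y) (X1 *m J *m Y) (X *m J *m Y1) (X1 *m dW *m Y) (X *m dW *m Y1)
  (X1 *m W *m Y1) (X *m (V *m W) *m Y) => *.
by rewrite !mxE; ring.
Qed.

Section JacobiMatrixWeight.
Context {R : realType}.
Local Notation C := R[i].
Variables a b v : R.
Implicit Types (A B : 'M[{poly C}]_2) (t : R).
Local Open Scope complex_scope.
Local Open Scope sesquilinear_scope.
Local Notation toC := (map_poly (real_complex R)).

Definition weight_poly : 'M[{poly C}]_2 :=
  'X^2 *: constmx (W2 a b v) + 'X *: constmx (W1 a b v) + constmx (W0 a).

Definition drift_poly : 'M[{poly C}]_2 :=
  constmx (matC a b v) - 'X *: constmx (matU a b).

Definition diffop_poly A : 'M[{poly C}]_2 :=
  ('X * (1 - 'X)) *: mxderiv (mxderiv A) + drift_poly *m mxderiv A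
  - constmx (matV v) *m A.

(** The zeroth order term of the concomitant below; it is forced by
    M' = W V - V W, where M = w t (1-t) J. *)
Definition antisym_poly : 'M[{poly C}]_2 := constmx (mx22 0 v (- v) 0).

(** The Pearson equation of the scalar weight w = t^a (1-t)^b:
    (t (1-t) w)' = pearson w. *)
Definition pearson_poly : {poly C} := toC ((a + 1)%:P - (a + b + 2) *: 'X).

Lemma Wabv_mxeval t :
  Wabv a b v t = (jacobi_weight a b t)%:C *: mxeval weight_poly t.
Proof.
rewrite /Wabv /weight_poly !mxevalD !mxevalZ !mxeval_constmx.
apply/matrixP => i j; rewrite !mxE !hornerXn !hornerX.
by rewrite -!(rmorphM, rmorphD, rmorphXn).
Qed.

Lemma Dabv_mxeval A : Dabv a b v (mxeval A) = mxeval (diffop_poly A).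
Proof.
apply/funext => t; rewrite /Dabv !mxderive_mxeval.
rewrite /diffop_poly /drift_poly !(mxevalD, mxevalN, mxevalM, mxevalZ).
rewrite !mxeval_constmx; congr (_ + _ - _).
  congr (_ *: _).
  by rewrite hornerM hornerD hornerN hornerX hornerC rmorphM rmorphB.
congr mulmx; apply/matrixP => i j.
by rewrite !mxE hornerX rmorphB rmorphM.
Qed.

Lemma mxinner_mxeval A B : mxinner (Wabv a b v) (mxeval A) (mxeval B) =
  \matrix_(i, j) jacobi_int a b ((adjmx A *m weight_poly *m B) i j).
Proof.
apply/matrixP => i j; rewrite !mxE /jacobi_int; congr cintegral01.
apply/funext => t; rewrite Wabv_mxeval adjmx_mxeval.
by rewrite -scalemxAr -scalemxAl -!mxevalM !mxE.
Qed.

Hypotheses (v0 : v != 0) (vp : v + a - b != 0) (vm : v - a + b != 0).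

(** Divided by w, the equation (t (1-t) W)' + t (1-t) w J = A^T W with
    A = C - t U.  Adding its transpose gives the usual symmetry equation
    2 (t (1-t) W)' = A^T W + W A. *)
Lemma weight_poly_pearson :
  pearson_poly *: weight_poly + ('X * (1 - 'X)) *: mxderiv weight_poly
  + ('X * (1 - 'X)) *: antisym_poly = drift_poly^T *m weight_poly.
Proof.
pose phi (x : R) : {poly C} := (x%:C)%:P.
have phiE x : (polyC \o real_complex R) x = phi x by [].
have phiD x y : phi (x + y) = phi x + phi y by rewrite /phi !rmorphD.
have phiN x : phi (- x) = - phi x by rewrite /phi !rmorphN.
have phiM x y : phi (x * y) = phi x * phi y by rewrite /phi !rmorphM.
have phi0 : phi 0 = 0 by rewrite /phi !rmorph0.
have phi1 : phi 1 = 1 by rewrite /phi !rmorph1.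
have phi_nat n : phi n%:R = n%:R by rewrite /phi !rmorph_nat.
have dphi x : (phi x)^`() = 0 by exact: derivC.
have pearsonE : pearson_poly = phi a + 1 - (phi a + phi b + 2) * 'X.
  rewrite /pearson_poly rmorphB/= map_polyZ/= map_polyX map_polyC/= -mul_polyC.
  by rewrite -phi1 -phi_nat -!phiD.
(* The entries of C and W_2 are polynomials in f, w1, w2 and the parameters,
   subject to the relations aE, E1 and E2; no division is left. *)
pose f := phi ((a - b) / v).
have aE : phi a = f * phi v + phi b by rewrite -phiM -phiD divfK// subrK.
have f1 : phi ((v + a - b) / v) = 1 + f.
  by rewrite -phi1 -phiD; congr phi; field.
have f2 : phi ((v - a + b) / v) = 1 - f.
  by rewrite -phi1 -phiN -phiD; congr phi; field.
pose w1 := phi (v * (v + 2 + a + b) / (v + a - b)).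
pose w2 := phi (v * (- v + 2 + a + b) / (v - a + b)).
have E1 : w1 * f + w1 - (phi v + 2 + phi a + phi b) = 0.
  rewrite -(phi_nat 2) -phiM -!phiD -phiN -phiD -[RHS]phi0.
  by congr phi; field; rewrite v0 vp.
have E2 : w2 * f - w2 - (phi v - 2 - phi a - phi b) = 0.
  rewrite -(phi_nat 2) -phiM -!phiN -!phiD -!phiN -!phiD -[RHS]phi0.
  by congr phi; field; rewrite v0 vm.
rewrite aE in E1 E2.
have lincomb (x y c e : {poly C}) : e = 0 -> x - y = c * e -> x = y.
  by move=> -> /eqP; rewrite mulr0 subr_eq0 => /eqP.
apply/matrixP => i j; move: j; apply: ord2_ind; move: i; apply: ord2_ind;
  rewrite !mxE !sum_ord2 !mxE pearsonE !phiE /= ?mulr0n ?mulr1n -/w1 -/w2 -/f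
    ?f1 ?f2 !(poly.derivE, dphi) !(phiD, phiN, phi1, phi_nat) -/f
    ?phiM ?(phiD, phiN, phi0, phi1) ?aE.
(* The two sides differ only in the coefficient of X^2, by E1 or E2 up to sign. *)
- by apply: (lincomb _ _ ('X^2) _ E1); ring.
- by apply: (lincomb _ _ (- 'X^2) _ E1); ring.
- by apply: (lincomb _ _ ('X^2) _ E2); ring.
- by apply: (lincomb _ _ (- 'X^2) _ E2); ring.
Qed.

Lemma trmx_weight_poly : weight_poly^T = weight_poly.
Proof.
apply/matrixP => i j; rewrite !mxE; move: i j.
by apply: ord2_ind; apply: ord2_ind.
Qed.

Lemma weight_poly_pearson_tr :
  pearson_poly *: weight_poly + ('X * (1 - 'X)) *: mxderiv weight_poly
  - ('X * (1 - 'X)) *: antisym_poly = weight_poly *m drift_poly.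
Proof.
rewrite -[RHS]trmxK trmx_mul trmx_weight_poly -weight_poly_pearson//.
have trD A B : (A + B)^T = A^T + B^T by exact: linearD.
have trZ p A : (p *: A)^T = p *: A^T by exact: linearZ.
rewrite trD trD !trZ trmx_weight_poly.
rewrite /mxderiv map_trmx trmx_weight_poly.
congr (_ + _); rewrite -scalerN; congr (_ *: _).
apply/matrixP; apply: ord2_ind; apply: ord2_ind;
  by rewrite !mxE/= ?rmorphN/= ?rmorphN/= ?rmorph0 ?opprK ?oppr0.
Qed.

(** Only the off-diagonal entry of the weight survives in the commutator with
    V, and that entry is the opposite of the Pearson polynomial. *)
Lemma weight_poly_commutator : pearson_poly *: antisym_poly =
  weight_poly *m constmx (matV v) - constmx (matV v) *m weight_poly.
Proof.
rewrite /pearson_poly rmorphB/= map_polyZ/= map_polyX map_polyC/= -mul_polyC.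
apply/matrixP; apply: ord2_ind; apply: ord2_ind;
  rewrite !mxE !sum_ord2 !mxE/=
    !(rmorphD, rmorphM, rmorphN, rmorph1, rmorph0)/=; ring.
Qed.

(** The boundary form of the operator; its factor t (1-t) w is left out. *)
Definition concomitant A B : 'M[{poly C}]_2 :=
  mxderiv (adjmx A) *m weight_poly *m B - adjmx A *m weight_poly *m mxderiv B
  + adjmx A *m antisym_poly *m B.

Lemma adjmx_deriv A : adjmx (mxderiv A) = mxderiv (adjmx A).
Proof. by apply/matrixP => i j; rewrite !mxE deriv_map. Qed.

Lemma adjmxD A B : adjmx (A + B) = adjmx A + adjmx B.
Proof. by rewrite /adjmx linearD map_mxD. Qed.

Lemma adjmxN A : adjmx (- A) = - adjmx A.
Proof. by rewrite /adjmx linearN map_mxN. Qed.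

Lemma adjmxM A B : adjmx (A *m B) = adjmx B *m adjmx A.
Proof. by rewrite /adjmx trmx_mul map_mxM. Qed.

Lemma adjmxZ (r : {poly R}) A : adjmx (toC r *: A) = toC r *: adjmx A.
Proof.
rewrite /adjmx linearZ map_mxZ/=; congr (_ *: _).
by apply/polyP => k; rewrite !coef_map; exact: conjc_real.
Qed.

Lemma adjmx_constmx (M : 'M[R]_2) : adjmx (constmx M) = (constmx M)^T.
Proof.
apply/matrixP => i j; rewrite !mxE map_polyC; congr polyC; exact: conjc_real.
Qed.

Lemma mxderivB A B : mxderiv (A - B) = mxderiv A - mxderiv B.
Proof. exact: map_mxB. Qed.

Lemma mxderivD A B : mxderiv (A + B) = mxderiv A + mxderiv B.
Proof. exact: map_mxD. Qed.

Lemma mxderiv_constmx (M : 'M[R]_2) : mxderiv (constmx M) = 0.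
Proof. by apply/matrixP => i j; rewrite !mxE derivC. Qed.

Lemma polyX_onem_toC : 'X * (1 - 'X) = toC ('X * (1 - 'X)) :> {poly C}.
Proof. by rewrite rmorphM rmorphB rmorph1/= map_polyX. Qed.

Lemma polyX_toC : 'X = toC 'X :> {poly C}. Proof. by rewrite map_polyX. Qed.

Lemma adjmx_diffop A : adjmx (diffop_poly A) =
  ('X * (1 - 'X)) *: mxderiv (mxderiv (adjmx A))
  + mxderiv (adjmx A) *m drift_poly^T - adjmx A *m constmx (matV v).
Proof.
have adjX : adjmx (('X * (1 - 'X)) *: mxderiv (mxderiv A)) =
    ('X * (1 - 'X)) *: mxderiv (mxderiv (adjmx A)).
  by rewrite polyX_onem_toC adjmxZ !adjmx_deriv.
have adjD : adjmx drift_poly = drift_poly^T.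
  rewrite /drift_poly adjmxD adjmxN polyX_toC adjmxZ !adjmx_constmx.
  by apply/matrixP => i j; rewrite !mxE.
rewrite /diffop_poly !(adjmxD, adjmxN) adjX !adjmxM adjD adjmx_deriv.
congr (_ + _ - _ *m _); rewrite adjmx_constmx; apply/matrixP.
by apply: ord2_ind; apply: ord2_ind; rewrite !mxE.
Qed.

(** The right side, multiplied by w, is the derivative of
    t (1-t) w times the concomitant. *)
Lemma lagrange_identity A B :
  adjmx (diffop_poly A) *m weight_poly *m B
  - adjmx A *m weight_poly *m diffop_poly B =
  pearson_poly *: concomitant A B
  + ('X * (1 - 'X)) *: mxderiv (concomitant A B).
Proof.
rewrite adjmx_diffop /concomitant.
rewrite mxderivD mxderivB mxderivM mxderivM mxderivM mxderivM mxderivM mxderivM.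
rewrite mxderiv_constmx mulmx0 addr0 ![in RHS]mulmxDl.
exact: mulmx_lagrange weight_poly_pearson
  weight_poly_pearson_tr weight_poly_commutator.
Qed.

Lemma mxinner_diffop_symmetric A B : -1 < a -> -1 < b ->
  mxinner (Wabv a b v) (mxeval (diffop_poly A)) (mxeval B) =
  mxinner (Wabv a b v) (mxeval A) (mxeval (diffop_poly B)).
Proof.
move=> a1 b1; rewrite !mxinner_mxeval; apply/matrixP => i j; rewrite !mxE.
apply/eqP; rewrite -subr_eq0 -jacobi_intB//; apply/eqP.
have /matrixP/(_ i j) := lagrange_identity A B.
rewrite !mxE => ->; rewrite polyX_onem_toC; exact: jacobi_int_derive.
Qed.

Lemma Wabv_symmetric : -1 < a -> -1 < b ->
  symmetric_wrt (Wabv a b v) (Dabv a b v).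
Proof.
move=> a1 b1 P Q; rewrite !mxpolyfunE !Dabv_mxeval.
exact: mxinner_diffop_symmetric.
Qed.

Lemma cintegrable_Wabv (n : nat) (i j : 'I_2) : -1 < a -> -1 < b ->
  cintegrable01 (fun t => (t ^+ n)%:C * Wabv a b v t i j).
Proof.
move=> a1 b1.
rewrite (_ : (fun t => _) =
    fun t => (jacobi_weight a b t)%:C * ('X^n * weight_poly i j).[t%:C]).
  exact: cintegrable_jacobi.
apply/funext => t.
by rewrite Wabv_mxeval 2!mxE /horner_eval hornerM hornerXn rmorphXn mulrCA.
Qed.

End JacobiMatrixWeight.

(** * The weight and its operator *)

Lemma Wabv_matrix_weight (R : realType) (a b v : R) :
  `|a - b| < `|v| -> `|v| < a + b + 2 -> matrix_weight (Wabv a b v).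
Proof.
move=> h1 h2.
have [a1 b1] : -1 < a /\ -1 < b.
  by move: (lt_trans h1 h2); rewrite ltr_norml => /andP[? ?]; split; lra.
split=> [t t01|n i j]; last exact: cintegrable_Wabv.
have w0 := jacobi_gt0 a b _ t01.
have [W00 detW] := weight_quadratic_posdef _ _ _ _ h1 h2 t01.
rewrite /Wabv -/(jacobi_weight a b t).
set W := _ + _ in W00 detW *.
have WT : (jacobi_weight a b t *: W)^T = jacobi_weight a b t *: W.
  apply/matrixP; apply: ord2_ind; apply: ord2_ind; by rewrite !mxE.
clearbody W; split; first exact: hermsymmx_complexmx.
apply: posdefmx_complexmx => //; first by rewrite mxE mulr_gt0.
rewrite !mxE exprMn; set c := jacobi_weight a b t.
rewrite (_ : c * _ * _ = c ^+ 2 * (W 0 0 * W 1 1)); last by ring.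
by rewrite ltr_pM2l// exprn_gt0.
Qed.

Theorem proposition4p1 (R : realType) (alpha beta v : R)
    (h1 : `|alpha - beta| < `|v|) (h2 : `|v| < alpha + beta + 2) :
  matrix_weight (Wabv alpha beta v) /\
  symmetric_wrt (Wabv alpha beta v) (Dabv alpha beta v).
Proof.
split; first exact: Wabv_matrix_weight.
have [a1 b1] : -1 < alpha /\ -1 < beta.
  by move: (lt_trans h1 h2); rewrite ltr_norml => /andP[? ?]; split; lra.
have /and3P[v0 vp vm] : [&& v != 0, v + alpha - beta != 0 & v - alpha + beta != 0].
  move: h1; have [v0|v0|->] := ltrgt0P v; last by rewrite normr_lt0.
    by rewrite ltr_norml => /andP[? ?]; apply/and3P; split; lra.
  by rewrite ltr_norml => /andP[? ?]; apply/and3P; split; lra.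
exact: Wabv_symmetric.
Qed.
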